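(* Let $k$ be a field of characteristic $2$, let $s,t$ be algebraically independent over $k$, and let $\mathfrak G(x)=x^2+sx+t$. Then $$\lim_{n\to\infty}\mathrm{FPP}\big(\operatorname{Gal}(\mathfrak G^n(x)/k(s,t))\big)=\frac13.$$
   Context: $\mathfrak G^n$ is $n$-fold composition; $\operatorname{Gal}(\mathfrak G^n(x)/k(s,t))$ is the Galois group of its splitting field over $k(s,t)$, acting on the roots of $\mathfrak G^n(x)$. For such a group $G$, $\mathrm{FPP}(G)$ is the proportion of elements of $G$ that fix at least one root of $\mathfrak G^n(x)$. *)

(* Defs.v *)
From HB Require Import structures.
From mathcomp Require Import all_boot all_order all_algebra all_fingroup all_field.
From mathcomp Require Import fraction mpoly.
Set Implicit Arguments. Unset Strict Implicit. Unset Printing Implicit Defensive.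
Import GRing.Theory Num.Theory.
Local Open Scope ring_scope.

Definition kst (k : fieldType) : fieldType := {fraction {mpoly k[2]}}.

Definition s_var (k : fieldType) : kst k := FracField.tofrac ('X_0 : {mpoly k[2]}).
Definition t_var (k : fieldType) : kst k := FracField.tofrac ('X_1 : {mpoly k[2]}).

Definition frakG (k : fieldType) : {poly kst k} :=
  'X^2 + (s_var k)%:P * 'X + (t_var k)%:P.

Definition frakG_iter (k : fieldType) (n : nat) : {poly kst k} :=
  iter n (fun q => q \Po frakG k) 'X.

Definition FPP (F : fieldType) (L : splittingFieldType F) (rs : seq L) : rat :=
  (#|[set g in ('Gal(<<1 & rs>>%VS / 1%VS))%g | has (fun r => g r == r) rs]|%:R
   / #|('Gal(<<1 & rs>>%VS / 1%VS))%g|%:R).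

(* Main.v *)
Require Import Defs.
From HB Require Import structures.
From mathcomp Require Import all_boot all_order all_algebra all_fingroup all_field.
From mathcomp Require Import fraction mpoly generic_quotient.
From mathcomp Require Import ring zify.
Import Order.TTheory GRing.Theory Num.Theory.
Local Open Scope ring_scope.

(**
In characteristic 2 the map A(x) = x^2 + s x is additive, so the roots of G^n
form a coset r + V_n of V_n = ker A^n, which is a cyclic module over
F_2[A] / (A^n), generated by any v with A^(n-1)(v) = s.  A Galois element x is
determined by its displacements (x(v) - v, x(r) - r) in V_(n-1) x V_n, and it
fixes a root iff x(r) - r lies in the submodule generated by x(v) - v.

All pairs of displacements occur, because [k(s,t)(v, r) : k(s,t)] = 2^(2n-1).
Indeed w = G(r) - r satisfies A^n(w) = t, so that s and w are algebraically
independent and t is a polynomial of degree 2^n in w over k[s]; and v has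
degree 2^(n-1) over k(w)(s) because it is totally ramified at s (Eisenstein).
Counting the pairs (y, b) with b in the submodule generated by y gives
FPP = 1/3 + 1/(3 * 2^(2n-1)).
*)

(** * Eisenstein's criterion *)

Lemma integral_exp {R K : comNzRingType} (io : {rmorphism R -> K}) y n :
  integralOver io y -> integralOver io (y ^+ n).
Proof.
move=> iy; elim: n => [|n IH]; first by rewrite expr0; apply: integral1.
by rewrite exprS; apply: integral_mul.
Qed.

Section Eisenstein.

Context {D : idomainType} {L : fieldType} (io : {rmorphism {poly D} -> L}).
Hypothesis io_inj : injective io.

(** A monic equation for [y = c/X], multiplied by [X^m], becomes [c^m] plus a multiple of [X];
    setting [X = 0] leaves [c(0)^m = 0]. *)
Lemma coef0_integral_mulX (c : {poly D}) y :
  integralOver io y -> io c = io 'X * y -> c`_0 = 0.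
Proof.
case=> q mq /rootP qy E; set m := (size q).-1.
have sq : size q = m.+1 by rewrite /m prednK // size_poly_gt0 monic_neq0.
pose r := \sum_(i < m.+1) q`_i * 'X^(m - i) * c ^+ i.
have r0 : r = 0.
  apply: io_inj; rewrite rmorph0 -[RHS](mulr0 (io 'X ^+ m)) -qy.
  rewrite (@horner_coef_wide _ m.+1); last by rewrite -sq size_poly.
  rewrite /r rmorph_sum mulr_sumr; apply: eq_bigr => i _.
  have im : (i <= m)%N by rewrite -ltnS.
  rewrite coef_map !rmorphM !rmorphXn /= E exprMn.
  have -> : io 'X ^+ m = io 'X ^+ (m - i) * io 'X ^+ i by rewrite -exprD subnK.
  by ring.
have : r.[0] = 0 by rewrite r0 horner0.
rewrite /r horner_sum big_ord_recr /= big1 ?add0r => [|i _].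
  rewrite subnn expr0 mulr1.
  have -> : q`_m = 1 by move/monicP: mq; rewrite /lead_coef sq.
  by rewrite mul1r horner_exp -horner_coef0 => /eqP; rewrite expf_eq0 => /andP[_ /eqP].
by rewrite !hornerE expr0n subn_eq0 leqNgt ltn_ord /= mulr0 mul0r.
Qed.

(* Eisenstein's criterion: [1 + v h] plays the role of a unit, so [s = 'X] is
   associated to [v ^+ N].  If [i] is minimal with [p`_i] prime to [s], the
   relation [p(v) = 0] makes [p`_i] a multiple of [v], hence [p`_i ^+ N] an
   integral multiple of [s]. *)
Lemma ramified_free {N : nat} {v h : L} :
  integralOver io v -> integralOver io h -> v ^+ N = io 'X * (1 + v * h) ->
  forall p : {poly {poly D}}, (size p <= N)%N -> (map_poly io p).[v] = 0 -> p = 0.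
Proof.
move=> iv ih vN p; set s := io 'X.
have s0 : s != 0.
  by rewrite /s -(rmorph0 io) (inj_eq io_inj) polyX_eq0.
have iX : integralOver io s by apply: integral_id.
have i1h : integralOver io (1 + v * h).
  by apply: integral_add; [apply: integral1 | apply: integral_mul].
(* Induction on a bound for the sizes of the coefficients: once all are shown divisible by ['X],
   dividing [p] by ['X] lowers it. *)
have [B] : exists B, (sizeY p <= B)%N by exists (sizeY p).
elim: B p => [|B IH] p pB pN pv.
  by move: pB; rewrite leqn0 sizeY_eq0 => /eqP.
have [->//|pn0] := eqVneq p 0.
have N0 : (0 < N)%N by apply: leq_trans pN; rewrite size_poly_gt0.
have v0 : v != 0.
  apply/eqP => v0; move: vN; rewrite v0 expr0n eqn0Ngt N0 /= mul0r addr0 mulr1.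
  by move/eqP; rewrite eq_sym (negbTE s0).
have E : \sum_(i < N) io p`_i * v ^+ i = 0.
  rewrite -[RHS]pv (@horner_coef_wide _ N) ?(leq_trans (size_poly _ _)) //.
  by apply: eq_bigr => i _; rewrite coef_map.
have ramif : forall i, (i < N)%N -> p`_i`_0 = 0.
  move=> i; elim/ltn_ind: i => i IHi iN.
  pose p' j := \poly_(l < size p`_j) p`_j`_l.+1.
  have p'E j : (j < i)%N -> p`_j = 'X * p' j.
    move=> ji; apply/polyP => l; rewrite coefXM; case: l => [|l] /=.
      by apply: IHi => //; apply: ltn_trans iN.
    rewrite coef_poly; case: ltnP => // sl.
    by rewrite nth_default // (leq_trans sl).
  pose a := \sum_(j < i) io (p' j) * v ^+ j.
  pose b := \sum_(j < N - i.+1) io p`_(j + i.+1)%N * v ^+ j.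
  have Eab : s * a + (io p`_i + v * b) * v ^+ i = 0.
    rewrite -[RHS]E -(big_mkord xpredT (fun j => io p`_j * v ^+ j)).
    rewrite (@big_cat_nat _ _ _ i) //=; last exact: ltnW.
    rewrite big_mkord (big_ltn iN) -[X in index_iota X _]add0n big_addn big_mkord.
    congr (_ + _).
      by rewrite mulr_sumr; apply: eq_bigr => j _; rewrite p'E // rmorphM mulrA.
    rewrite mulrDl; congr (_ + _).
    rewrite /b mulr_sumr mulr_suml; apply: eq_bigr => j _.
    by rewrite addnS exprS exprD; ring.
  have ia : integralOver io a.
    apply: (big_ind (integralOver io)) => [|x y|j _]; first exact: integral0.
      exact: integral_add.
    by apply: integral_mul; [apply: integral_id | apply: integral_exp].
  have ib : integralOver io b.
    apply: (big_ind (integralOver io)) => [|x y|j _]; first exact: integral0.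
      exact: integral_add.
    by apply: integral_mul; [apply: integral_id | apply: integral_exp].
  pose u := 1 + v * h.
  (* Multiplying [Eab] by [u] turns [u * s] into [v^N]; cancelling [v^i] then expresses [p_i] as
     [v * y] with this integral [y]. *)
  pose y := - (v ^+ (N - i.+1) * a + u * b + io p`_i * h).
  have iy : integralOver io y.
    apply: integral_opp; apply: integral_add; first apply: integral_add.
    - by apply: integral_mul => //; apply: integral_exp.
    - exact: integral_mul.
    - by apply: integral_mul => //; apply: integral_id.
  have Ey : io p`_i = v * y.
    apply: (mulIf (expf_neq0 i v0)); apply/eqP; rewrite -subr_eq0; apply/eqP.
    have vNi : v ^+ N = v ^+ (N - i.+1) * v * v ^+ i.
      by rewrite -exprSr -exprD; congr (_ ^+ _); lia.
    transitivity (u * (s * a + (io p`_i + v * b) * v ^+ i)); last by rewrite Eab mulr0.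
    rewrite mulrDr mulrA [u * s]mulrC -vN vNi /y /u; ring.
  have : (p`_i ^+ N)`_0 = 0.
    apply: (@coef0_integral_mulX _ (u * y ^+ N)).
      by apply: integral_mul => //; apply: integral_exp.
    by rewrite rmorphXn /= Ey exprMn vN mulrA.
  by rewrite -!horner_coef0 horner_exp => /eqP; rewrite expf_eq0 => /andP[_ /eqP].
pose p1 := \poly_(i < size p) (\poly_(l < (size p`_i).-1) p`_i`_l.+1).
have p1E : p = 'X%:P * p1.
  apply/polyP => i; rewrite coefCM coef_poly; case: ltnP => si; last first.
    by rewrite nth_default ?mulr0.
  apply/polyP => l; rewrite coefXM; case: l => [|l] /=.
    exact/ramif/(leq_trans si).
  rewrite coef_poly; case: ltnP => // sl.
  by rewrite nth_default //; lia.
have p10 : p1 = 0.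
  apply: IH.
  - rewrite sizeYE; apply/leq_sizeP => j Bj; apply/polyP => i; rewrite coef0 coef_swapXY.
    rewrite coef_poly; case: ifP => _; last by rewrite coef0.
    rewrite coef_poly ltnNge (leq_trans _ Bj) //.
    by rewrite -subn1 leq_subLR add1n (leq_trans (max_size_coefXY p i)).
  - exact: leq_trans (size_poly _ _) pN.
  - move: pv; rewrite p1E rmorphM /= map_polyC hornerM hornerC => /eqP.
    by rewrite mulf_eq0 (negbTE s0) => /eqP.
by move: pn0; rewrite p1E p10 mulr0 eqxx.
Qed.

End Eisenstein.

(** * Transcendence and base expansion *)

(** Separating constant terms writes the sum as [Q * B + S] with [deg S < d <= deg B], so both [Q]
    and [S] vanish, and [Q = 0] is a shorter relation of the same form. *)
Lemma expansion_uniq (C : idomainType) (B : {poly C}) (d : nat)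
    (c : 'I_d -> {poly C}) :
  B \is monic -> (d < size B)%N ->
  \sum_(j < d) (c j \Po B) * 'X^j = 0 -> forall j, c j = 0.
Proof.
move=> mB sB; have [M] : exists M, forall j, (size (c j) <= M)%N.
  by exists (\max_j size (c j)) => j; apply: leq_bigmax.
elim: M c => [|M IH] c cM E; first by move=> j; apply/eqP; rewrite -size_poly_leq0.
pose c' j := drop_poly 1 (c j).
pose Q := \sum_(j < d) (c' j \Po B) * 'X^j.
pose S := \poly_(j < d) (if insub j is Some i then (c i)`_0 else 0).
have cE j : c j = c' j * 'X + ((c j)`_0)%:P.
  apply/polyP => -[|i]; rewrite coefD coefMX coefC /= ?add0r //.
  by rewrite coef_drop_poly addr0 addn1.
have QS : Q * B + S = 0.
  rewrite -[RHS]E /S poly_def /Q mulr_suml -big_split /=; apply: eq_bigr => j _.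
  rewrite valK [in RHS]cE comp_polyD comp_polyM comp_polyX comp_polyC -mul_polyC; ring.
have sS : (size S <= d)%N by apply: size_poly.
have Q0 : Q = 0.
  apply/eqP; apply: contraTT sB => Q0; rewrite -leqNgt; apply: leq_trans sS.
  have -> : S = - (Q * B) by apply/eqP; rewrite -addr_eq0 addrC QS.
  rewrite size_polyN size_Mmonic //.
  by have := size_poly_gt0 Q; rewrite Q0; case: (size Q) => // q _; rewrite addSn /= leq_addl.
have c'0 : forall j, c' j = 0.
  apply: IH Q0 => j; rewrite size_drop_poly; have := cM j; lia.
have S0 : S = 0 by rewrite -QS Q0 mul0r add0r.
move=> j; rewrite cE c'0 mul0r add0r.
have : S`_j = 0 by rewrite S0 coef0.
by rewrite coef_poly ltn_ord valK => ->.
Qed.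

(* If [q(w) = 0] with leading coefficient [a], then [a w] is integral, hence so
   is [a ^+ e * B(w)] for some [e]. *)
Lemma transcendental_horner {C : idomainType} {L : fieldType}
    {sg : {rmorphism C -> L}} {B : {poly C}} {w : L} :
  (forall p, (map_poly sg p).[(map_poly sg B).[w]] = 0 -> p = 0) ->
  forall q, (map_poly sg q).[w] = 0 -> q = 0.
Proof.
set t := (map_poly sg B).[w] => ht q qw; apply/eqP/negP => /negP q0.
pose a := lead_coef q; have a0 : a != 0 by rewrite lead_coef_eq0.
have sgi x : sg x = 0 -> x = 0.
  move=> sx; apply/eqP; rewrite -polyC_eq0; apply/eqP/ht.
  by rewrite map_polyC hornerC.
have iaw : integralOver sg (sg a * w).
  case Eq: (size q) => [|d]; first by rewrite -size_poly_eq0 Eq in q0.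
  have aE : a = q`_d by rewrite /a /lead_coef Eq.
  case: d Eq aE => [|d] Eq aE.
    move: qw; rewrite (@horner_coef_wide _ 1); last by rewrite -Eq size_poly.
    rewrite big_ord1 coef_map expr0 mulr1 /= -aE => /sgi a1.
    by rewrite a1 eqxx in a0.
  (* This is [a^d q(X/a)], where [q] has degree [d + 1]. *)
  pose p := 'X^(d.+1) + \poly_(i < d.+1) (q`_i * a ^+ (d - i)).
  have mp : p \is monic by rewrite monicE lead_coefDl ?lead_coefXn ?size_polyXn ?ltnS ?size_poly.
  exists p => //; apply/rootP.
  rewrite (@horner_coef_wide _ d.+2); last first.
    by rewrite (leq_trans (size_poly _ _)) // size_polyDl ?size_polyXn ?ltnS ?size_poly.
  rewrite -[RHS](mulr0 (sg a ^+ d)) -[X in _ = _ * X]qw.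
  rewrite (@horner_coef_wide _ d.+2) -?Eq ?size_poly // Eq.
  rewrite mulr_sumr; apply: eq_bigr => -[i /= id] _; rewrite !coef_map /=.
  rewrite coefD coefXn coef_poly; move: id; rewrite ltnS leq_eqVlt => /predU1P[->|id].
    rewrite eqxx ltnn addr0 rmorph1 mul1r -aE exprMn exprS; ring.
  rewrite id ltn_eqF // add0r rmorphM rmorphXn /= exprMn.
  have -> : sg a ^+ d = sg a ^+ (d - i) * sg a ^+ i by rewrite -exprD subnK.
  by ring.
have [e [p mp /rootP pe]] : exists e, integralOver sg (sg (a ^+ e) * t).
  rewrite /t; elim/poly_ind: B {t ht} => [|p c [e IH]].
    by exists 0%N; rewrite rmorph0 horner0 mulr0; apply: integral0.
  (* Horner's scheme: [a^(e+1) (p(w) w + c) = (a^e p(w)) (a w) + a^(e+1) c]. *)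
  exists e.+1; rewrite rmorphD rmorphM /= map_polyX map_polyC !hornerE /=.
  rewrite exprS rmorphM mulrDr; apply: integral_add; last first.
    by rewrite -!rmorphM; apply: integral_id.
  rewrite [sg a * _]mulrC mulrACA; exact: integral_mul.
have ae0 : a ^+ e != 0 by rewrite expf_neq0.
(* Rescaling the variable turns the monic equation of [a^e t] into a relation for [t], which [ht]
   makes zero; but rescaling by a nonzero constant keeps [p] nonzero. *)
have : p \Po ((a ^+ e) *: 'X) = 0.
  by apply: ht; rewrite map_comp_poly horner_comp linearZ /= map_polyX hornerZ hornerX.
move/eqP; rewrite comp_poly2_eq0; last by rewrite size_scale // size_polyX.
by rewrite (negbTE (monic_neq0 mp)).
Qed.

(** * The additive map and its ramification at s *)

(** The additive part of [G], as [G(x) = A(x) + t]. The ring is arbitrary so that the same formula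
    also builds the polynomials [polyA]. *)
Definition opA {C : comNzRingType} (s x : C) : C := x ^+ 2 + s * x.

Fixpoint polyA {C : comNzRingType} (s : C) (n : nat) : {poly C} :=
  if n is n'.+1 then opA s%:P (polyA s n') else 'X.

Lemma horner_polyA (C : comNzRingType) (s x : C) n :
  (polyA s n).[x] = iter n (opA s) x.
Proof. by elim: n => [|n IH] /=; rewrite ?hornerX // /opA !hornerE IH. Qed.

Lemma map_polyA (C C' : comNzRingType) (f : {rmorphism C -> C'}) (s : C) n :
  map_poly f (polyA s n) = polyA (f s) n.
Proof.
elim: n => [|n IH] /=; first exact: map_polyX.
by rewrite rmorphD rmorphXn rmorphM /= map_polyC IH.
Qed.

Lemma polyA_monic (C : idomainType) (s : C) n :
  (polyA s n \is monic) * (size (polyA s n) = (2 ^ n).+1).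
Proof.
elim: n => [|n [mA sA]] /=; first by rewrite monicX size_polyX.
have s2 : size (polyA s n ^+ 2) = (2 ^ n.+1).+1.
  by rewrite expr2 size_mul ?monic_neq0 // sA expnS; lia.
have lt : (size (s%:P * polyA s n)%R < size (polyA s n ^+ 2)%R)%N.
  rewrite s2 mul_polyC (leq_ltn_trans (size_scale_leq _ _)) // sA ltnS.
  by rewrite ltn_exp2l.
rewrite /opA size_polyDl // s2; split=> //.
by rewrite monicE lead_coefDl // -monicE monic_exp.
Qed.

(** Modulo [s] the map is squaring. The error keeps a factor [x] besides [s], as the Eisenstein form
    [v^N = s (1 + v h)] requires. *)
Lemma iter_opA_ramified {D : comNzRingType} {L : fieldType} {io : {rmorphism D -> L}}
    {s : D} {x : L} m : integralOver io x ->
  exists2 h, integralOver io h &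
    iter m (opA (io s)) x = x ^+ (2 ^ m) + io s * x * h.
Proof.
move=> ix; elim: m => [|m [h ih E]].
  by exists 0; [apply: integral0 | rewrite expn0 expr1 mulr0 addr0].
exists (x ^+ (2 ^ m) * h *+ 2 + io s * x * h ^+ 2 + x ^+ (2 ^ m).-1 + io s * h).
  have is_ : integralOver io (io s) by apply: integral_id.
  rewrite mulr2n; repeat first [apply: integral_add | apply: integral_mul | apply: integral_exp | by []].
rewrite iterS E /opA expnS mulnC exprM.
have -> : io s * (x ^+ (2 ^ m) + io s * x * h) =
    io s * (x * x ^+ (2 ^ m).-1 + io s * x * h).
  by rewrite -exprS prednK // expn_gt0.
by ring.
Qed.

(* The roles of the two variables are exchanged between [t] and [w]: the
   coefficients [c i j] are in [k[s][t]], and Eisenstein is applied over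
   [k[w][s]]. *)
Lemma torsion_division_free {k L : fieldType} {sg : {rmorphism {poly k} -> L}} {n m : nat} {v w t : L} :
    (forall p, (map_poly sg p).[t] = 0 -> p = 0) ->
    iter n (opA (sg 'X)) w = t -> iter m (opA (sg 'X)) v = sg 'X ->
  forall c : 'I_(2 ^ m) -> 'I_(2 ^ n) -> {poly {poly k}},
    \sum_i \sum_j (map_poly sg (c i j)).[t] * w ^+ j * v ^+ i = 0 ->
  forall i j, c i j = 0.
Proof.
set s := sg 'X => ht wt vs c Ec.
have tE : t = (map_poly sg (polyA 'X n)).[w] by rewrite map_polyA horner_polyA.
have hw : forall q, (map_poly sg q).[w] = 0 -> q = 0.
  by move: ht; rewrite tE; apply: transcendental_horner.
(* [io] sends the inner variable to [w] and the outer one to [s], realizing [k[w][s]] in [L]; it is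
   injective because [w] is transcendental over [k[s]]. *)
pose io : {rmorphism {poly {poly k}} -> L} :=
  (horner_eval w \o map_poly sg \o swapXY)%FUN.
have ioE q : io (swapXY q) = (map_poly sg q).[w] by rewrite /= swapXYK.
have io_inj : injective io.
  move=> p q; rewrite -[p]swapXYK -[q]swapXYK => /eqP.
  by rewrite -subr_eq0 -rmorphB -raddfB ioE => /eqP/hw/eqP; rewrite subr_eq0 => /eqP->.
have ioX : io 'X = s by rewrite /= swapXY_X map_polyC /horner_eval hornerC.
have iv : integralOver io v.
  exists (polyA 'X m - 'X%:P).
    rewrite monicE lead_coefDl ?polyA_monic -?monicE ?polyA_monic //.
    by rewrite size_polyN size_polyC polyX_eq0 ltnS expn_gt0.
  rewrite /root rmorphB /= map_polyA map_polyC hornerD hornerN hornerC horner_polyA.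
  by rewrite ioX vs subr_eq0; apply/eqP/esym/ioX.
have [h ih vh] := @iter_opA_ramified _ _ io 'X v m iv.
rewrite ioX vs in vh.
have vN : v ^+ (2 ^ m) = io 'X * (1 + v * - h).
  by rewrite ioX mulrDr mulr1 mulrN mulrN mulrA {1}vh addrK.
(* [q i] is the coefficient of [v^i] after substituting [t = A^n(w)]. Eisenstein kills each [q i];
   uniqueness of the expansion in base [A^n] then kills each [c i j]. *)
pose q i := \sum_j (c i j \Po polyA 'X n) * 'X^j.
pose P := \poly_(i < 2 ^ m) (if insub i is Some i' then swapXY (q i') else 0).
have P0 : P = 0.
  apply: (ramified_free io io_inj iv (integral_opp ih) vN) (size_poly _ _) _.
  rewrite /P poly_def rmorph_sum horner_sum -[RHS]Ec; apply: eq_bigr => i _.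
  rewrite valK -mul_polyC rmorphM /= map_polyC map_polyXn hornerM hornerC hornerXn.
  rewrite [_ (swapXY _)]ioE /q rmorph_sum horner_sum mulr_suml; apply: eq_bigr => j _.
  rewrite rmorphM /= map_polyXn hornerM hornerXn map_comp_poly horner_comp.
  by rewrite map_polyA horner_polyA wt.
move=> i; apply: (@expansion_uniq _ (polyA 'X n)); rewrite ?polyA_monic //.
rewrite -/(q i) -[q i]swapXYK.
have : P`_i = 0 by rewrite P0 coef0.
by rewrite coef_poly ltn_ord valK => ->; rewrite raddf0.
Qed.

(** * From k[s][t] to k(s,t) *)

Lemma fraction_ratio {R : idomainType} (x : {fraction R}) :
  exists a b : R, b != 0 /\ x * FracField.tofrac b = FracField.tofrac a.
Proof.
elim/quotW: x => x; exists (frac x).1, (frac x).2; split; first exact: denom_ratioP.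
unlock FracField.tofrac; rewrite -[LHS]FracField.pi_mul.
apply/eqmodP; rewrite /= FracField.equivfE /FracField.mulf.
by rewrite !numden_Ratio ?(oner_eq0, mulf_neq0, denom_ratioP) // !mulr1 mulrC.
Qed.

Lemma common_denominator {R : idomainType} {I : finType} (x : I -> {fraction R}) :
  exists2 d : R, d != 0 &
    exists c : I -> R, forall i, x i * FracField.tofrac d = FracField.tofrac (c i).
Proof.
have /fin_all_exists[a /fin_all_exists[b ab]] i := fraction_ratio (x i).
exists (\prod_i b i); first by apply/prodf_neq0 => i _; case: (ab i).
exists (fun i => a i * \prod_(j | j != i) b j) => i.
by rewrite (bigD1 i) //= !rmorphM /= mulrA (proj2 (ab i)).
Qed.

Definition in_X0 {k : fieldType} : {rmorphism {poly k} -> {mpoly k[2]}} :=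
  (horner_eval 'X_0 \o map_poly (@mpolyC 2 k))%FUN.

Definition mpoly2_poly {k : fieldType} : {rmorphism {mpoly k[2]} -> {poly {poly k}}} :=
  mmap (polyC \o polyC)%FUN (fun i : 'I_2 => if i == ord0 then 'X%:P else 'X).

Lemma in_X0_X {k : fieldType} : in_X0 'X = 'X_0 :> {mpoly k[2]}.
Proof. by rewrite /= map_polyX /horner_eval hornerX. Qed.

Lemma mpoly2_poly_in_X0 {k : fieldType} (p : {poly k}) : mpoly2_poly (in_X0 p) = p%:P.
Proof.
elim/poly_ind: p => [|p c IH]; first by rewrite !rmorph0.
rewrite !rmorphD !rmorphM IH in_X0_X /= [map_poly _ c%:P]map_polyC /horner_eval hornerC.
by rewrite mmapC mmapX mmap1U.
Qed.

Section Eval2.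

Context {k : fieldType} {L : comNzRingType} (g : {rmorphism {mpoly k[2]} -> L}).

Lemma horner_mpoly2_poly (m : {mpoly k[2]}) :
  (map_poly (g \o in_X0) (mpoly2_poly m)).[g 'X_1] = g m.
Proof.
pose h : {rmorphism {mpoly k[2]} -> L} :=
  (horner_eval (g 'X_1) \o map_poly (g \o in_X0) \o mpoly2_poly)%FUN.
rewrite -[LHS]/(h m).
have hC c : h c%:MP = g c%:MP.
  rewrite /= mmapC /= map_polyC /horner_eval hornerC /= map_polyC.
  by rewrite /horner_eval hornerC.
have hX i : h 'X_i = g 'X_i.
  rewrite /= mmapX mmap1U; case: i => -[|[|//]] i2 /=.
    rewrite map_polyC /horner_eval hornerC -[LHS]/(g (in_X0 'X)) in_X0_X.
    by congr (g 'X__); apply: val_inj.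
  by rewrite map_polyX /horner_eval hornerX; congr (g 'X__); apply: val_inj.
elim/mpolyind: m => [|c m p _ _ IH]; first by rewrite !rmorph0.
rewrite !rmorphD IH -mul_mpolyC !rmorphM hC mpolyXE_id !rmorph_prod; congr (_ * _ + _).
by apply: eq_bigr => i _; rewrite !rmorphXn hX.
Qed.

(** [mpoly2_poly] recovers [p] from its value at ['X_1] in [k[s,t]], so only zero vanishes there. *)
Lemma horner_inj_poly2 (p : {poly {poly k}}) : injective g ->
  (map_poly (g \o in_X0) p).[g 'X_1] = 0 -> p = 0.
Proof.
move=> g_inj; rewrite map_poly_comp horner_map -[X in _ = X](rmorph0 g) => /g_inj p0.
have -> : p = mpoly2_poly (map_poly in_X0 p).['X_1].
  rewrite -horner_map -map_poly_comp /=.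
  rewrite (@eq_map_poly _ _ _ polyC); last exact: mpoly2_poly_in_X0.
  by rewrite /= mmapX mmap1U /= -/(comp_poly _ _) comp_polyXr.
by rewrite p0 rmorph0.
Qed.

End Eval2.

(** A common denominator reduces to coefficients in [k[s,t]]. The independent monomials [w^j v^i]
    will bound the degree of the splitting field from below. *)
Lemma torsion_division_lin_free {k : fieldType} {L : fieldType}
    (f : {rmorphism kst k -> L}) {n m : nat} {v w : L} :
    iter n (opA (f (s_var k))) w = f (t_var k) ->
    iter m (opA (f (s_var k))) v = f (s_var k) ->
  forall M : 'M[kst k]_(2 ^ m, 2 ^ n),
    \sum_i \sum_j f (M i j) * w ^+ j * v ^+ i = 0 -> M = 0.
Proof.
move=> wt vs M EM.
pose g : {rmorphism {mpoly k[2]} -> L} := (f \o @FracField.tofrac _)%FUN.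
have g_inj : injective g.
  move=> x y /= /fmorph_inj E; apply/eqP; rewrite -tofrac_eq; exact/eqP.
have sE : f (s_var k) = (g \o in_X0)%FUN 'X by rewrite /comp in_X0_X.
rewrite sE in wt vs.
have [d d0 [c cE]] := common_denominator (fun ij : 'I_(2 ^ m) * 'I_(2 ^ n) => M ij.1 ij.2).
have c0 : forall i j, mpoly2_poly (c (i, j)) = 0.
  apply: (torsion_division_free (sg := (g \o in_X0)%FUN) _ wt vs).
    move=> p; exact: horner_inj_poly2.
  rewrite -[RHS](mulr0 (g d)) -[X in _ = _ * X]EM mulr_sumr; apply: eq_bigr => i _.
  rewrite mulr_sumr; apply: eq_bigr => j _.
  by rewrite horner_mpoly2_poly /= -(cE (i, j)) rmorphM /= !mulrA [f (M i j) * _]mulrC.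
apply/matrixP => i j; rewrite mxE; apply/eqP.
have : c (i, j) = 0 by apply: g_inj; rewrite -horner_mpoly2_poly c0 !rmorph0 horner0.
have := cE (i, j) => /= E c00; move: E; rewrite c00 rmorph0 => /eqP.
by rewrite mulf_eq0 tofrac_eq0 (negbTE d0) orbF.
Qed.

(** * The torsion of the additive map *)

Lemma opA_fmorph {C C' : comNzRingType} (f : {rmorphism C -> C'}) (s x : C) :
  f (opA s x) = opA (f s) (f x).
Proof. by rewrite rmorphD rmorphXn rmorphM. Qed.

Section Char2.

Context {L : fieldType} (s : L).
Hypotheses (char2 : 2%N \in [pchar L]) (s0 : s != 0).
Local Notation A := (opA s).

Lemma opAD x y : A (x + y) = A x + A y.
Proof. by rewrite /opA -!(pFrobenius_autE char2) rmorphD /=; ring. Qed.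

Lemma iter_opAD n x y : iter n A (x + y) = iter n A x + iter n A y.
Proof. by elim: n => //= n ->; apply: opAD. Qed.

Lemma iter_opA0 n : iter n A 0 = 0.
Proof. by elim: n => //= n ->; rewrite /opA expr0n mulr0 addr0. Qed.

Lemma iter_opAN n x : iter n A (- x) = - iter n A x.
Proof. by rewrite !(oppr_pchar2 char2). Qed.

Lemma iter_opAB n x y : iter n A (x - y) = iter n A x - iter n A y.
Proof. by rewrite iter_opAD iter_opAN. Qed.

Lemma opA_eq0 x : A x = 0 -> x = 0 \/ x = s.
Proof.
rewrite /opA expr2 -mulrDl => /eqP; rewrite mulf_eq0 => /orP[|/eqP->]; last by left.
by rewrite addr_eq0 (oppr_pchar2 char2) => /eqP; right.
Qed.

Lemma opA_s : A s = 0.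
Proof. by rewrite /opA -expr2 (addrr_pchar2 char2). Qed.

Lemma iter_opA_leq i j x : (i <= j)%N -> iter i A x = 0 -> iter j A x = 0.
Proof. by move=> ij x0; rewrite -(subnK ij) iterD x0 iter_opA0. Qed.

Context (m : nat) (v : L).
Hypothesis vs : iter m A v = s.

(** For [j <= m], [A^j (e j) = s] is a nonzero root of [A], so [e j] is killed by [A^(j+1)] but not
    by [A^j]. *)
Let e j := iter (m - j) A v.

Lemma iter_opA_e j : (j <= m)%N -> iter j A (e j) = s.
Proof. by move=> jm; rewrite -iterD subnKC. Qed.

(** The kernel of [A^j] for [j <= m + 1], as an explicit list so that it can be counted; each step
    adjoins one coset. *)
Fixpoint torsion (j : nat) : seq L :=
  if j is j'.+1 then torsion j' ++ [seq x + e j' | x <- torsion j'] else [:: 0].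

Lemma size_torsion j : size (torsion j) = (2 ^ j)%N.
Proof. by elim: j => //= j IH; rewrite size_cat size_map IH expnS mul2n addnn. Qed.

(** [A^(j+1) x = 0] means that [A^j x] is 0 or [s], and the second case is the coset of [e j]. *)
Lemma mem_torsion j x : (j <= m.+1)%N -> (x \in torsion j) = (iter j A x == 0).
Proof.
elim: j x => [|j IH] x jm /=; first by rewrite inE.
rewrite mem_cat IH; last exact: ltnW.
have -> : (x \in [seq y + e j | y <- torsion j]) = (iter j A x == s).
  apply/mapP/eqP => [[y]|xs].
    rewrite IH => [/eqP y0 ->|]; last exact: ltnW.
    by rewrite iter_opAD y0 add0r iter_opA_e.
  exists (x - e j); last by rewrite subrK.
  by rewrite IH 1?ltnW // iter_opAB xs iter_opA_e // subrr.
apply/orP/eqP => [[/eqP->|/eqP->]|/opA_eq0[]->]; rewrite ?eqxx; [exact: (iter_opA0 1)|exact: opA_s|by left|by right].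
Qed.

Lemma torsion_uniq j : (j <= m.+1)%N -> uniq (torsion j).
Proof.
elim: j => [//|j IH] jm /=; rewrite cat_uniq map_inj_uniq; last exact: addIr.
rewrite IH 1?ltnW //= andbT; apply/hasPn => _ /mapP[y yt ->].
move: yt; rewrite !mem_torsion 1?ltnW // => /eqP y0.
by rewrite iter_opAD y0 add0r iter_opA_e.
Qed.

Lemma count_torsion j : (j <= m.+1)%N ->
  count (fun x => iter j A x == 0) (torsion m.+1) = (2 ^ j)%N.
Proof.
move=> jm; rewrite -size_filter -size_torsion; apply/perm_size/uniq_perm.
- exact/filter_uniq/torsion_uniq.
- exact: torsion_uniq.
move=> x; rewrite mem_filter !mem_torsion //; apply: andb_idr => /eqP x0.
exact/eqP/(iter_opA_leq _ _ _ jm x0).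
Qed.

(* The submodules of [ker A^(m+1)] form a chain, so this says that [b] belongs
   to the submodule generated by [y]. *)
Definition level_le (y b : L) : bool :=
  all (fun i => (iter i A y == 0) ==> (iter i A b == 0)) (iota 0 m.+2).

Lemma level_leP y b :
  reflect (forall i, (i <= m.+1)%N -> iter i A y = 0 -> iter i A b = 0) (level_le y b).
Proof.
apply: (iffP allP) => H i.
  move=> im /eqP y0; apply/eqP; have := H i; rewrite mem_iota add0n ltnS => /(_ im).
  by rewrite y0.
by rewrite mem_iota ltnS => im; apply/implyP => /eqP /(H _ im) ->.
Qed.

(** An element [y] of exact level [i] admits [2^i] values of [b]. There are [2^(i-1)] such [y] for
    [1 <= i <= j], besides zero, so the count is [1 + sum_i 2^(2i-1) = (2^(2j+1) + 1)/3]. *)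
Lemma count_level_le j : (j <= m)%N ->
  (3 * count (fun p => level_le p.1 p.2) [seq (y, b) | y <- torsion j, b <- torsion m.+1]
    = 2 ^ (2 * j).+1 + 1)%N.
Proof.
elim: j => [_|j IH jm].
  rewrite allpairs1l count_map (eq_count (a2 := fun x => iter 0 A x == 0)).
    by rewrite count_torsion.
  move=> b /=; apply/level_leP/eqP => [H|-> i _ _]; first exact: (H 0%N).
  exact: iter_opA0.
(* The elements added at this step have exact level [j + 1], so the condition on [b] is
   [A^(j+1) b = 0]. *)
have new y : y \in [seq x + e j | x <- torsion j] ->
    count (level_le y) (torsion m.+1) = (2 ^ j.+1)%N.
  case/mapP => y0; rewrite mem_torsion ?(leq_trans (ltnW jm)) // => /eqP y00 ->.
  have ys : iter j A (y0 + e j) = s by rewrite iter_opAD y00 add0r iter_opA_e // ltnW.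
  rewrite -count_torsion; last by rewrite (leq_trans jm).
  apply: eq_count => b; apply/level_leP/eqP => [H|b0 i im yi].
    by apply: H; rewrite ?(leq_trans jm) //= ys opA_s.
  have [ij|] := leqP i j; last by move/iter_opA_leq; apply.
  by move: s0; rewrite -ys (iter_opA_leq _ _ _ ij yi) eqxx.
rewrite /= allpairs_cat count_cat mulnDr IH; last exact: ltnW.
rewrite count_flatten -map_comp.
set c := map _ _; have /all_pred1P-> : all (pred1 (2 ^ j.+1)%N) c.
  by apply/allP => _ /mapP[y yt ->] /=; rewrite count_map; apply/eqP/new.
rewrite sumn_nseq !size_map size_torsion !mul2n -!addnn !addSn !addnS !expnS !expnD; nia.
Qed.

(** [T] is linear over [F_2[A]], so it maps [ker A^(m+1)], generated by [v], onto the submodule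
    generated by [T v]. It is used with [T = x - 1] for a Galois element [x]. *)
Lemma image_level_le (T : L -> L) b :
    {morph T : x y / x + y} -> {morph T : x / A x} -> iter m.+1 A b = 0 ->
  level_le (T v) b <-> exists2 x, iter m.+1 A x = 0 & T x = b.
Proof.
move=> TD TA b0; have TAn n x : T (iter n A x) = iter n A (T x).
  by elim: n => //= n <-.
have T0 : T 0 = 0 by apply: (addIr (T 0)); rewrite -TD !add0r.
have v0 : iter m.+1 A v = 0 by rewrite /= vs opA_s.
have Tv0 : iter m.+1 A (T v) = 0 by rewrite -TAn v0.
split=> [/level_leP H|[x /eqP x0 <-]].
  have ex : exists i, iter i A (T v) == 0 by exists m.+1; apply/eqP.
  case: (ex_minnP ex) => l /eqP l0 lmin.
  have lm : (l <= m.+1)%N by apply: lmin; apply/eqP.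
  have {H b0 lm} : iter l A b = 0 by apply: H.
  elim: {1 3}l (leqnn l) b => [|j IH] jl b bj; first by exists 0 => //; rewrite ?iter_opA0 ?T0.
  have [/IH|] := opA_eq0 (iter j A b) bj; first by apply; apply: ltnW.
  (* By minimality of [l], [A^(l-1) (T v) = s]; hence [A^j] sends both [T u] and [b] to [s], and
     [b - T u] has lower level. *)
  move=> bs; pose u := iter (l - j.+1) A v.
  have us : iter j A (T u) = s.
    rewrite /u TAn -iterD.
    have lj : l = (j + (l - j.+1)).+1 by rewrite -addSn subnKC.
    have := l0; rewrite {1}lj => /opA_eq0[/eqP|//] /lmin.
    by rewrite {1}lj ltnn.
  have [|x x0 Tx] := IH (ltnW jl) (b - T u); first by rewrite iter_opAB bs us subrr.
  exists (x + u); last by rewrite TD Tx subrK.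
  by rewrite iter_opAD x0 add0r /u -iterD addnC iterD v0 iter_opA0.
(* Conversely [x] is a sum of elements [e j = A^(m-j) v], so a power of [A] that kills [T v] kills
   [T x]. *)
apply/level_leP => i im iv.
move: x0; rewrite -mem_torsion //.
have : (m.+1 <= m.+1)%N by [].
elim: {1 3}(m.+1) x => [|j IH] x jm /=; first by rewrite inE => /eqP->; rewrite T0 iter_opA0.
rewrite mem_cat => /orP[/IH|/mapP[y yt ->]]; first by apply; apply: ltnW.
rewrite TD iter_opAD (IH y) ?(ltnW jm) // add0r.
by rewrite /e TAn -iterD addnC iterD iv iter_opA0.
Qed.

End Char2.

(** * Roots of the iterates and Galois action *)

Section Roots.

Context {F L : fieldType} (f : {rmorphism F -> L}) (a b : F).
Hypotheses (char2 : 2%N \in [pchar F]) (a0 : a != 0).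

Let G : {poly F} := 'X^2 + a%:P * 'X + b%:P.
Let Gn n : {poly F} := iter n (fun q => q \Po G) 'X.
Let s := f a.
Let t := f b.
Let A := opA s.
Let g z := A z + t.

Let char2L : 2%N \in [pchar L].
Proof. by rewrite (fmorph_pchar f). Qed.

Let s0 : s != 0.
Proof. by rewrite fmorph_eq0. Qed.

Lemma horner_quad_iter n z :
  (map_poly f (Gn n)).[z] = iter n g z.
Proof.
elim: n z => [|n IH] z; first by rewrite map_polyX hornerX.
rewrite /Gn iterS map_comp_poly horner_comp iterSr -IH; congr (_.[_]).
by rewrite /G !rmorphD !rmorphM /= map_polyX !map_polyC !hornerE.
Qed.

Lemma iter_quadD n x y : iter n g (x + y) = iter n g x + iter n A y.
Proof.
by elim: n => //= n ->; rewrite /g /A (opAD _ char2L) addrAC.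
Qed.

(** In characteristic 2 the derivative of [G] is the constant [a], and the chain rule applies. A
    nonzero constant derivative makes the iterates separable. *)
Lemma deriv_quad_iter n : (Gn n)^`() = (a ^+ n)%:P.
Proof.
elim: n => [|n IH]; first by rewrite derivX.
rewrite /Gn iterS deriv_comp -/(Gn n) IH comp_polyC /G.
rewrite !derivD derivC derivXn derivM derivC derivX mul0r add0r mulr1 addr0.
by rewrite -[_ *+ 2]mulr_natr -polyC_natr (pcharf0 char2) mulr0 add0r -polyCM exprSr.
Qed.

Lemma size_quad_iter n : size (Gn n) = (2 ^ n).+1.
Proof.
have s2 : size G = 3%N.
  rewrite /G -addrA size_polyDl size_polyXn // ltnS.
  rewrite (leq_trans (size_polyD _ _)) // geq_max mul_polyC.
  by rewrite (leq_trans (size_scale_leq _ _)) ?size_polyX // (leq_trans (size_polyC_leq1 _)).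
elim: n => [|n IH]; first by rewrite size_polyX.
have /= := size_comp_poly (Gn n) G.
rewrite IH s2 /= muln2 -mul2n -expnS -/(Gn n.+1) => <-.
rewrite prednK // size_poly_gt0 /=.
by rewrite comp_poly_eq0 // ?s2 // -size_poly_eq0 IH.
Qed.

Context {rs : seq L} {m : nat}.
Hypothesis rsE : map_poly f (Gn m.+1) = \prod_(z <- rs) ('X - z%:P).

Lemma mem_quad_roots z : (z \in rs) = (iter m.+1 g z == 0).
Proof. by rewrite -horner_quad_iter rsE -root_prod_XsubC. Qed.

Lemma uniq_quad_roots : uniq rs.
Proof.
rewrite -separable_prod_XsubC -rsE unlock deriv_map deriv_quad_iter map_polyC.
by rewrite -alg_polyC coprimepZr ?coprimep1 // fmorph_eq0 expf_neq0.
Qed.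

Lemma size_quad_roots : size rs = (2 ^ m.+1)%N.
Proof.
by apply: succn_inj; rewrite -(size_prod_XsubC _ id) -rsE size_map_poly size_quad_iter.
Qed.

Lemma torsion_translate r z : r \in rs -> (z \in rs) = (iter m.+1 A (z - r) == 0).
Proof.
rewrite !mem_quad_roots => /eqP r0.
by rewrite -{1}(subrK r z) addrC iter_quadD r0 add0r.
Qed.

(** If [A^m] killed all [2^(m+1)] distinct differences [z - r], it would have more roots than its
    degree [2^m]. A nonzero value [A^m (z - r)] is a root of [A], hence [s]. *)
Lemma generator_exists r : r \in rs -> exists2 z, z \in rs & iter m A (z - r) = s.
Proof.
move=> rr.
have [/hasP[z zr zm]|/hasPn all0] := boolP (has (fun z => iter m A (z - r) != 0) rs).
  exists z => //; have := zr; rewrite (torsion_translate _ _ rr) => /eqP.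
  by move/(opA_eq0 _ char2L (iter m A (z - r))) => [z0|//]; rewrite z0 eqxx in zm.
have [mA sA] := polyA_monic _ s m.
have : (size [seq (z - r)%R | z <- rs] < size (polyA s m))%N.
  apply: max_poly_roots; first exact: monic_neq0.
    apply/allP => _ /mapP[z zr ->]; rewrite /root horner_polyA.
    by have := all0 z zr; rewrite negbK.
  by rewrite map_inj_uniq ?uniq_quad_roots //; apply: addIr.
by rewrite size_map sA size_quad_roots ltnS leq_exp2l // ltnn.
Qed.

(** With [w = G(r) - r], compare [G^(m+1)(G(r)) = G(0) = t] and [G^(m+1)(r + w) = A^(m+1)(w)]. *)
Lemma division_point r : r \in rs -> iter m.+1 A (g r - r) = t.
Proof.
move=> rr; have := iter_quadD m.+1 r (g r - r).
rewrite subrKC -iterSr iterS; move: rr; rewrite mem_quad_roots => /eqP ->; rewrite add0r => <-.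
by rewrite /g /A /opA expr0n mulr0 !add0r.
Qed.

End Roots.

(** * The Galois group and its fixed-point proportion *)

Section GaloisAction.

Context {F : fieldType} {L : splittingFieldType F} (a b : F) (rs : seq L) (m : nat).
Hypotheses (char2 : 2%N \in [pchar F]) (a0 : a != 0).
Hypothesis rsE : map_poly (in_alg L)
    (iter m.+1 (fun q => q \Po ('X^2 + a%:P * 'X + b%:P)) 'X) = \prod_(z <- rs) ('X - z%:P).

Let s : L := in_alg L a.
Let t : L := in_alg L b.
Let A := opA s.
Let g z := A z + t.

Hypothesis lin_free : forall v w, iter m.+1 A w = t -> iter m A v = s ->
  forall M : 'M[F]_(2 ^ m, 2 ^ m.+1),
    \sum_i \sum_j in_alg L (M i j) * w ^+ j * v ^+ i = 0 -> M = 0.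

Let E := <<1 & rs>>%AS.
Let H := 'Gal(E / 1)%G.

Let char2L : 2%N \in [pchar L].
Proof. by rewrite (fmorph_pchar (in_alg L)). Qed.

Let s0 : s != 0.
Proof. by rewrite fmorph_eq0. Qed.

Lemma galois_splitting : galois 1 E.
Proof.
apply/splitting_galoisField.
exists (\prod_(z <- rs) ('X - z%:P)); split.
- rewrite -rsE; apply/polyOverP => i; rewrite coef_map /=.
  by apply: rpredZ; apply: mem1v.
- by rewrite separable_prod_XsubC (uniq_quad_roots (in_alg L) _ _ char2 a0 rsE).
- by exists rs => //; rewrite eqpxx.
Qed.

Lemma in_alg_splitting c : in_alg L c \in E.
Proof. by apply: rpredZ; apply: mem1v. Qed.

Lemma mem_splitting z : z \in rs -> z \in E.
Proof. by move=> zr; apply: seqv_sub_adjoin. Qed.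

Lemma gal_in_alg (x : gal_of E) c : x (in_alg L c) = in_alg L c.
Proof. by rewrite /= linearZ rmorph1. Qed.

Lemma gal_opA (x : gal_of E) z : x (A z) = A (x z).
Proof. by rewrite /A [LHS]opA_fmorph; congr opA; apply: gal_in_alg. Qed.

Lemma gal_root (x : gal_of E) z : z \in rs -> x z \in rs.
Proof.
have xg n y : x (iter n g y) = iter n g (x y).
  by elim: n => //= n <-; rewrite /g [LHS]rmorphD; congr (_ + _); [apply: gal_opA | apply: gal_in_alg].
rewrite !(mem_quad_roots (in_alg L) a b rsE) => /eqP z0.
by have := xg m.+1 z; rewrite z0 rmorph0 => <-.
Qed.

Context {r z1 : L}.
Hypotheses (rr : r \in rs) (zr : z1 \in rs).
Let v := z1 - r.
Hypothesis vs : iter m A v = s.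

Let w := g r - r.

(** The order of [H] is the dimension of [E], which contains the [2^m * 2^(m+1)] independent
    monomials [w^j v^i]. *)
Lemma card_gal_ge : (2 ^ (2 * m).+1 <= #|H|)%N.
Proof.
rewrite -(galois_dim galois_splitting) dimv1 divn1.
have vE : v \in E by rewrite rpredB ?mem_splitting.
have wE : w \in E.
  by rewrite /w /g /A /opA !(rpredB, rpredD, rpredX, rpredM) ?in_alg_splitting ?mem_splitting.
pose Psi (M : 'M[F]_(2 ^ m, 2 ^ m.+1)) : L := \sum_i \sum_j M i j *: (w ^+ j * v ^+ i).
have lin : linear Psi.
  move=> c M N; rewrite /Psi scaler_sumr -big_split /=; apply: eq_bigr => i _.
  rewrite scaler_sumr -big_split /=; apply: eq_bigr => j _.
  by rewrite !mxE scalerDl scalerA.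
pose Psil : {linear 'M[F]_(2 ^ m, 2 ^ m.+1) -> L} := HB.pack Psi (GRing.isLinear.Build _ _ _ _ Psi lin).
have inj : (fullv :&: lker (linfun Psil))%VS = 0%VS.
  apply/eqP; rewrite capfv -subv0; apply/subvP => M; rewrite memv_ker lfunE memv0 => /eqP M0.
  have wt : iter m.+1 A w = t := division_point (in_alg L) _ _ char2 rsE _ rr.
  apply/eqP/(lin_free v w wt vs).
  rewrite -[RHS]M0; apply: eq_bigr => i _; apply: eq_bigr => j _.
  by rewrite /= -mulrA mulr_algl.
have := limg_dim_eq inj; rewrite dimvf dim_matrix => dimE.
have -> : (2 ^ (2 * m).+1 = 2 ^ m * 2 ^ m.+1)%N by rewrite -expnD; rewrite addnS mul2n addnn.
rewrite -[(2 ^ m * _)%N]dimE; apply: dimvS; apply/subvP => _ /memv_imgP[M _ ->]; rewrite lfunE /=.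
by do 2!apply: rpred_sum => ? _; rewrite rpredZ // rpredM // rpredX.
Qed.

Lemma gal_ext (x y : gal_of E) : {in rs, x =1 y} -> x = y.
Proof.
move=> xy; suff /eqP : (x * y^-1)%g = 1%g by rewrite -eq_mulgV1 => /eqP.
apply/eqP/gal_eqP => z zE; rewrite gal_id.
have /subvP/(_ z zE)/mem_fixedFieldP[_] : (E <= fixedField [set x * y^-1]%g)%VS.
  apply/Fadjoin_seqP; split; first exact: sub1v.
  move=> u ur; apply/fixedFieldP; first exact: mem_splitting.
  move=> _ /set1P->; rewrite galM ?mem_splitting // xy // -galM ?mem_splitting //.
  by rewrite mulgV gal_id.
by apply; rewrite inE.
Qed.

Let displacement (x : gal_of E) := (x v - v, x r - r).

(** [x v] determines [x] on the module generated by [v], and every root is [r] plus an element of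
    that module. *)
Lemma displacement_inj : injective displacement.
Proof.
move=> x y [/addIr xyv /addIr xyr]; apply: gal_ext => z zrs.
have An (u : gal_of E) n c : u (iter n A c) = iter n A (u c).
  by elim: n => //= n <-; apply: gal_opA.
have xyt j u : u \in torsion s m v j -> x u = y u.
  elim: j u => [|j IH] u /=; first by rewrite inE => /eqP->; rewrite !rmorph0.
  rewrite mem_cat => /orP[/IH //|/mapP[c /IH xyc ->]].
  by rewrite [LHS]rmorphD [RHS]rmorphD; congr (_ + _); [apply: xyc | rewrite [LHS]An [RHS]An xyv].
have : z - r \in torsion s m v m.+1.
  by rewrite (mem_torsion _ char2L) // -(torsion_translate (in_alg L) a b char2 rsE).
by move/xyt; rewrite [LHS]rmorphB [RHS]rmorphB; move: xyr => /= -> /addIr.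
Qed.

Let pairs := [seq (y, c) | y <- torsion s m v m, c <- torsion s m v m.+1].

(** The first component lies in [ker A^m], one level below [v], because
    [A^m (x v - v) = x s - s = 0]. *)
Lemma displacement_mem x : displacement x \in pairs.
Proof.
apply: allpairs_f; rewrite (mem_torsion _ char2L) //.
  have An n c : x (iter n A c) = iter n A (x c).
    by elim: n => //= n <-; apply: gal_opA.
  by rewrite (iter_opAB _ char2L) -An vs [x s]gal_in_alg subrr.
by rewrite -(torsion_translate (in_alg L) a b char2 rsE) // gal_root.
Qed.

Lemma card_gal : #|H| = (2 ^ (2 * m).+1)%N.
Proof.
apply/eqP; rewrite eqn_leq card_gal_ge andbT.
have -> : (2 ^ (2 * m).+1 = size pairs)%N.
  by rewrite size_allpairs !size_torsion -expnD addnS mul2n addnn.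
rewrite cardE -(size_map displacement); apply: uniq_leq_size.
  by rewrite (map_inj_uniq displacement_inj) enum_uniq.
by move=> _ /mapP[x _ ->]; apply: displacement_mem.
Qed.

Lemma perm_displacement : perm_eq [seq displacement x | x <- enum H] pairs.
Proof.
have uP : uniq [seq displacement x | x <- enum H] by rewrite (map_inj_uniq displacement_inj) enum_uniq.
have sub : {subset [seq displacement x | x <- enum H] <= pairs}.
  by move=> _ /mapP[x _ ->]; apply: displacement_mem.
have sz : (size pairs <= size [seq displacement x | x <- enum H])%N.
  by rewrite size_map -cardE card_gal size_allpairs !size_torsion -expnD addnS mul2n addnn.
have [_ e] := uniq_min_size uP sub sz.
by apply: uniq_perm => //; apply: leq_size_uniq uP sub sz.
Qed.

(** In characteristic 2, [x] fixes [r + u] iff [(x - 1) u = (x - 1) r]; so a root is fixed iff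
    [x r - r] lies in the image of the torsion under [x - 1]. *)
Lemma fixes_root_level_le (x : gal_of E) :
  has (fun z => x z == z) rs = level_le s m (x v - v) (x r - r).
Proof.
pose T u := x u - u.
have TD : {morph T : u c / u + c} by move=> u c; rewrite /T rmorphD opprD addrACA.
have TA : {morph T : u / A u}.
  by move=> u; rewrite /T gal_opA; apply/esym; exact: (iter_opAB s char2L 1).
have Tr0 : iter m.+1 A (T r) = 0.
  by apply/eqP; rewrite -(torsion_translate (in_alg L) a b char2 rsE) // gal_root.
have fixE u : (x (r + u) == r + u) = (T u == T r).
  rewrite -[LHS]subr_eq0 -/(T (r + u)) TD addr_eq0 eq_sym.
  by rewrite (oppr_pchar2 char2L).
apply/hasP/idP => [[z zrs xz]|/(image_level_le s char2L m v vs T (T r) TD TA Tr0)[u u0 Tu]].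
  apply/(image_level_le s char2L m v vs T (T r) TD TA Tr0); exists (z - r).
    by apply/eqP; rewrite -(torsion_translate (in_alg L) a b char2 rsE).
  by apply/eqP; rewrite -fixE addrC subrK.
exists (r + u); last by rewrite fixE Tu.
by rewrite (torsion_translate (in_alg L) a b char2 rsE r) // addrC addKr u0.
Qed.

Lemma FPP_value : FPP rs = 1 / 3 + 1 / (3 * 2 ^+ (2 * m).+1).
Proof.
(* Displacements carry the elements fixing a root onto the pairs counted by [count_level_le] at
   [j = m]. *)
have num : (3 * #|[set x in H | has (fun z => x z == z) rs]| = 2 ^ (2 * m).+1 + 1)%N.
  rewrite -(count_level_le s char2L s0 m v vs m) // -(seq.permP perm_displacement).
  rewrite count_map -size_filter cardE; congr (3 * _)%N.
  apply/perm_size/uniq_perm; [exact: enum_uniq | exact/filter_uniq/enum_uniq | move=> x].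
  by rewrite mem_enum [RHS]mem_filter mem_enum inE andbC fixes_root_level_le.
rewrite /FPP; move: num; set c := #|_| => num.
have -> : #|('Gal(<<1 & rs>>%VS / 1%VS))%g| = (2 ^ (2 * m).+1)%N by exact: card_gal.
have p0 : (2 ^+ (2 * m).+1 : rat) != 0 by rewrite expf_neq0.
have cE : 3 * (c%:R : rat) = 2 ^+ (2 * m).+1 + 1.
  by rewrite -(natrM _ 3) num natrD natrX.
rewrite natrX; move: p0 cE; set p := _ ^+ _ => p0 cE.
have -> : (c%:R : rat) = (p + 1) / 3 by rewrite -cE mulrC mulKf.
by field.
Qed.

End GaloisAction.

(** * The iterates over k(s,t) and the limit *)

Lemma pchar2_kst {k : fieldType} : 2%N \in [pchar k] -> 2%N \in [pchar (kst k)].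
Proof.
move=> char2; have [_ /eqP k2] := andP char2; apply/andP; split=> //; apply/eqP.
rewrite -(rmorph_nat (@FracField.tofrac {mpoly k[2]})) -(rmorph_nat (@mpolyC 2 k)).
by rewrite k2 !rmorph0.
Qed.

Lemma s_var_neq0 (k : fieldType) : s_var k != 0.
Proof.
rewrite tofrac_eq0 -(in_X0_X (k := k)).
apply/eqP => /(congr1 mpoly2_poly)/eqP.
by rewrite mpoly2_poly_in_X0 rmorph0 polyC_eq0 polyX_eq0.
Qed.

Lemma FPP_frakG_iter {k : fieldType} {L : splittingFieldType (kst k)} {rs : seq L} {m : nat} :
    2%N \in [pchar k] ->
    map_poly (in_alg L) (frakG_iter k m.+1) = \prod_(z <- rs) ('X - z%:P) ->
  FPP rs = 1 / 3 + 1 / (3 * 2 ^+ (2 * m).+1).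
Proof.
move=> char2 rsE; have ch2 := pchar2_kst char2; have s0 := s_var_neq0 k.
have [r rr] : exists r, r \in rs.
  have := size_quad_roots (in_alg L) _ _ rsE; case: (rs) => [|r rs'] szr.
    by have := expn_gt0 2 m.+1; rewrite -szr.
  by exists r; rewrite mem_head.
have [z zr zs] := generator_exists (in_alg L) _ _ ch2 s0 rsE r rr.
apply: (FPP_value _ _ rs m ch2 s0 rsE _ rr zr zs) => v w wt vs.
exact: (torsion_division_lin_free (in_alg L) wt vs).
Qed.

Lemma inv_expn_small (eps : rat) : 0 < eps ->
  exists N : nat, forall m : nat, (N <= m)%N -> 1 / (3 * 2 ^+ (2 * m).+1) < eps.
Proof.
(* [Num.bound eps^-1] exceeds [1/eps], and [m < 2^m <= 2^(2m+1)]. *)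
move=> e0; exists (Num.bound eps^-1) => m Nm.
have le : (Num.bound eps^-1 <= 2 ^ (2 * m).+1)%N.
  by rewrite (leq_trans Nm) // ltnW // (leq_trans (ltn_expl m (ltnSn 1))) // leq_exp2l //; lia.
have pm : eps^-1 < (2 ^ (2 * m).+1)%:R.
  by rewrite (lt_le_trans (archi_boundP _)) ?ler_nat // invr_ge0 ltW.
rewrite natrX in pm.
have p0 : 0 < 2 ^+ (2 * m).+1 :> rat by rewrite exprn_gt0.
rewrite div1r -[eps]invrK ltf_pV2 ?posrE ?invr_gt0 ?mulr_gt0 //.
by apply: (lt_le_trans pm); rewrite ler_peMl // ltW.
Qed.

Theorem theorem5p4 (k : fieldType) (char2 : 2%N \in [pchar k])
  (L : nat -> splittingFieldType (kst k)) (rs : forall n, seq (L n))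
  (hsplit : forall n, map_poly (in_alg (L n)) (frakG_iter k n)
                      = \prod_(z <- rs n) ('X - z%:P)) :
  forall eps : rat, 0 < eps ->
    exists N : nat, forall n : nat, (N <= n)%N ->
      `|FPP (rs n) - 1 / 3| < eps.
Proof.
(* The closed form is for the iterate [n = m + 1], so the threshold is shifted by one, which
   excludes [n = 0]. *)
move=> eps /inv_expn_small[N small]; exists N.+1 => -[//|m] /small.
rewrite (FPP_frakG_iter char2 (hsplit m.+1)) addrC addKr ger0_norm //.
by rewrite divr_ge0 // mulr_ge0 // exprn_ge0.
Qed.
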